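(* Let $n$ and $r$ be positive integers, let $q$ be a complex number with $q^m\neq 1$ for every positive integer $m<n$, and let $u_1,\ldots,u_{r+2}$ be formal variables. Let $$x_1=\frac{u_1}{1+u_1}$$ and, for $i=2,\ldots,r+2$, $$x_i=\sum_{j=i}^{r+1}(-1)^{j-i}\binom{j-2}{i-2}\left(u_j-\frac{u_{r+2}}{u_1^{r+2-j}}\right)+\frac{u_{r+2}}{u_1^{r+2-i}(1+u_1)^{i-1}}$$ (the sum being empty when $i=r+2$). Then $$\Psi_n^t(u_1,\ldots,u_{r+2};q)=\frac{\prod_{j=1}^{n-1}P^{t-1}(1-q^j)}{\prod_{j=1}^{n-1}P^{t}(1-q^j)},$$ where $$P^t(T)=T^{r+1}-(x_1+tx_2)T^r-t\sum_{i=0}^{r-1}(x_{r+2-i}-x_1x_{r+1-i})T^i,$$ and $P^{t-1}(T)$ is obtained from $P^t(T)$ by replacing $t$ with $t-1$.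
   Context: $\mathbb{N}$ is the set of positive integers and $t$ is a formal parameter. For a multi-index $\mathbf{k}=(k_1,\ldots,k_l)\in\mathbb{N}^l$ define the weight $\mathrm{wt}(\mathbf{k})=k_1+\cdots+k_l$, the depth $\mathrm{dep}(\mathbf{k})=l$, and for $i\in\mathbb{N}$ the $i$-height $\#\{j\mid k_j\geq i+1\}$. For $\mathbf{k}\in\mathbb{N}^l$ with $l\ge 1$, $$\overline{z}_n(\mathbf{k};q)=\sum_{n>m_1>\cdots>m_l>0}\frac{q^{(k_1-1)m_1+\cdots+(k_l-1)m_l}}{(1-q^{m_1})^{k_1}\cdots(1-q^{m_l})^{k_l}},$$ and its interpolated version, a polynomial in $t$, is $$\overline{z}_n^t(\mathbf{k};q)=\sum_{\mathbf{p}}\overline{z}_n(\mathbf{p};q)\,t^{l-\mathrm{dep}(\mathbf{p})},$$ where the sum runs over all $3^{l-1}$ ways of forming $\mathbf{p}=(k_1\Box\cdots\Box k_l)$ by filling each $\Box$ with '','' (comma), ''$+$'' or ''$-1+$''. For nonnegative integers $k,l,h_1,\ldots,h_r$ let $I(k,l,h_1,\ldots,h_r)$ be the set of multi-indices of weight $k$, depth $l$ and $i$-height $h_i$ for $i=1,\ldots,r$, and $$G_n^t(k,l,h_1,\ldots,h_r;q)=\sum_{\mathbf{k}\in I(k,l,h_1,\ldots,h_r)}\overline{z}_n^t(\mathbf{k};q),$$ which is $0$ when the index set is empty, except that $G_n^t(0,0,\ldots,0;q)=1$. The generating function is $$\Psi_n^t(u_1,\ldots,u_{r+2};q)=\sum_{k,l,h_1,\ldots,h_r\geq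 0}G_n^t(k,l,h_1,\ldots,h_r;q)\,u_1^{k-l-\sum_{j=1}^rh_j}u_2^{l-h_1}u_3^{h_1-h_2}\cdots u_{r+1}^{h_{r-1}-h_r}u_{r+2}^{h_r}.$$ The identity is one of formal power series in $u_1,\ldots,u_{r+2}$ (the negative powers of $u_1$ in $x_i$ cancel, so each $x_i$ is a power series). Empty products equal $1$. *)

(* Defs.v *)
From HB Require Import structures.
From mathcomp Require Import all_boot all_order all_algebra.
From mathcomp Require Export mpoly complex.
From mathcomp Require Export boolp classical_sets fsbigop reals.

Set Implicit Arguments.
Unset Strict Implicit.
Unset Printing Implicit Defensive.

Import Order.TTheory GRing.Theory Num.Theory.
Local Open Scope ring_scope.

Record mps (n : nat) (R : Type) := MPS { mpsc : 'X_{1..n} -> R }.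

HB.instance Definition _ n R := gen_eqMixin (mps n R).
HB.instance Definition _ n R := gen_choiceMixin (mps n R).

Section PowerSeriesRing.
Variables (n : nat) (R : comNzRingType).
Implicit Types f g h : mps n R.

Lemma mpsP f g : mpsc f =1 mpsc g -> f = g.
Proof. by case: f g => [f] [g] /= /funext ->. Qed.

Definition mps0 : mps n R := MPS (fun=> 0).
Definition mps_opp f : mps n R := MPS (fun m => - mpsc f m).
Definition mps_add f g : mps n R := MPS (fun m => mpsc f m + mpsc g m).

Lemma mps_addA : associative mps_add.
Proof. by move=> f g h; apply: mpsP => m /=; rewrite addrA. Qed.
Lemma mps_addC : commutative mps_add.
Proof. by move=> f g; apply: mpsP => m /=; rewrite addrC. Qed.
Lemma mps_add0 : left_id mps0 mps_add.
Proof. by move=> f; apply: mpsP => m /=; rewrite add0r. Qed.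
Lemma mps_addN : left_inverse mps0 mps_opp mps_add.
Proof. by move=> f; apply: mpsP => m /=; rewrite addNr. Qed.

HB.instance Definition _ := GRing.isZmodule.Build (mps n R)
  mps_addA mps_addC mps_add0 mps_addN.

Definition mpsC (c : R) : mps n R :=
  MPS (fun m => if m == 0%MM then c else 0).
Definition mpsX (i : 'I_n) : mps n R := MPS (fun m => (m == U_(i)%MM)%:R).
(** The degree bound only makes the index type finite: it follows from
    m = k.1 + k.2. *)
Definition mps_mul f g : mps n R :=
  MPS (fun m => \sum_(k : 'X_{1..n < (mdeg m).+1, (mdeg m).+1}
                      | m == (k.1 + k.2)%MM) mpsc f k.1 * mpsc g k.2).

Definition mps_trunc d f : {mpoly R[n]} :=
  \sum_(m : 'X_{1..n < d}) mpsc f m *: 'X_[m].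

Lemma mps_truncE d f m : (mdeg m < d)%N -> (mps_trunc d f)@_m = mpsc f m.
Proof. exact: mcoeff_mpoly. Qed.

Lemma eq_mcoeffM (p p' q q' : {mpoly R[n]}) m :
  (forall k, (mdeg k <= mdeg m)%N -> p@_k = p'@_k) ->
  (forall k, (mdeg k <= mdeg m)%N -> q@_k = q'@_k) ->
  (p * q)@_m = (p' * q')@_m.
Proof.
move=> ep eq; rewrite !mcoeffM; apply: eq_bigr => -[[a la] [b lb]] /= _.
by rewrite ep ?eq.
Qed.

Lemma mps_mulE d f g m : (mdeg m < d)%N ->
  mpsc (mps_mul f g) m = (mps_trunc d f * mps_trunc d g)@_m.
Proof.
move=> lt_md; rewrite mcoeffM /=; apply: eq_bigr => -[[a la] [b lb]] /= _.
rewrite !mps_truncE //; exact: leq_ltn_trans lt_md.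
Qed.

Lemma mps_mulA : associative mps_mul.
Proof.
move=> f g h; apply: mpsP => m; pose d := (mdeg m).+1.
rewrite !(@mps_mulE d) //.
transitivity ((mps_trunc d f * (mps_trunc d g * mps_trunc d h))@_m).
  by apply: eq_mcoeffM => // k lek; rewrite mps_truncE // (@mps_mulE d).
rewrite mulrA.
by apply: eq_mcoeffM => // k lek; rewrite mps_truncE // (@mps_mulE d).
Qed.

Lemma mps_mulC : commutative mps_mul.
Proof.
by move=> f g; apply: mpsP => m; rewrite !(@mps_mulE (mdeg m).+1) // mulrC.
Qed.

Lemma mps_mul1 : left_id (mpsC 1) mps_mul.
Proof.
move=> f; apply: mpsP => m; rewrite (@mps_mulE (mdeg m).+1) //.
rewrite -(mps_truncE f (ltnSn (mdeg m))) -[in RHS](mul1r (mps_trunc _ _)).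
apply: eq_mcoeffM => // k lek; rewrite mps_truncE // mcoeff1 /=.
by case: (k == 0%MM).
Qed.

Lemma mps_mulDl : left_distributive mps_mul (@GRing.add (mps n R)).
Proof.
move=> f g h; apply: mpsP => m; pose d := (mdeg m).+1.
transitivity (mpsc (mps_mul f h) m + mpsc (mps_mul g h) m); last by [].
rewrite !(@mps_mulE d) // -mcoeffD -mulrDl.
by apply: eq_mcoeffM => // k lek; rewrite mcoeffD !mps_truncE.
Qed.

Lemma mps_1neq0 : mpsC 1 != 0 :> mps n R.
Proof.
apply/eqP => /(congr1 (fun f => mpsc f 0%MM)) /= /eqP.
by rewrite eqxx oner_eq0.
Qed.

HB.instance Definition _ := GRing.Zmodule_isComNzRing.Build (mps n R)
  mps_mulA mps_mulC mps_mul1 mps_mulDl mps_1neq0.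

Definition mps_unit : {pred mps n R} := [pred f | `[< exists g, g * f = 1 >]].
Definition mps_inv f : mps n R :=
  if pselect (exists g, g * f = 1) is left ex then projT1 (cid ex) else f.

Lemma mps_mulVr : {in mps_unit, left_inverse 1 mps_inv *%R}.
Proof.
by move=> f /asboolP uf; rewrite /mps_inv; case: pselect => // ex; case: (cid _).
Qed.
Lemma mps_unitPl f g : g * f = 1 -> mps_unit f.
Proof. by move=> gf; apply/asboolP; exists g. Qed.
Lemma mps_inv_out : {in [predC mps_unit], mps_inv =1 id}.
Proof.
move=> f /negP nuf; rewrite /mps_inv; case: pselect => // ex.
by case: nuf; apply/asboolP.
Qed.

HB.instance Definition _ := GRing.ComNzRing_hasMulInverse.Build (mps n R)
  mps_mulVr mps_unitPl mps_inv_out.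

(** The sum of a family of power series in which every monomial has a nonzero
    coefficient in finitely many members only. *)
Definition mps_sum (I : choiceType) (F : I -> mps n R) : mps n R :=
  MPS (fun m => \sum_(i \in [set: I]%classic) mpsc (F i) m).

End PowerSeriesRing.

Section PowerSeriesIdomain.
Variables (n : nat) (R : idomainType).
Implicit Types f g : mps n R.

Lemma mps_low f : f != 0 ->
  exists2 m, mpsc f m != 0 & forall k, (k < m)%O -> mpsc f k = 0.
Proof.
move=> nzf; apply: contrapT => no; case/negP: nzf; apply/eqP/mpsP.
move=> m; elim/(@ltmwf n): m => m IH; apply: contrapT => /eqP nz; apply: no.
by exists m => // k /IH.
Qed.

Lemma mps_idomain : GRing.integral_domain_axiom (mps n R).
Proof.
move=> f g fg0; apply: contrapT => /negP; rewrite negb_or => /andP[].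
move=> /mps_low[a nza lowa] /mps_low[b nzb lowb].
have /eqP := congr1 (fun h => mpsc h (a + b)%MM) fg0; rewrite /=.
have da : (mdeg a < (mdeg (a + b)).+1)%N by rewrite mdegD ltnS leq_addr.
have db : (mdeg b < (mdeg (a + b)).+1)%N by rewrite mdegD ltnS leq_addl.
rewrite (bigD1 (BMultinom da, BMultinom db)) //= big1 ?addr0 => [|[k l] /=].
  by rewrite mulf_eq0 (negPf nza) (negPf nzb).
case/andP => /eqP eab neq.
have [/lowa ->|leak] := ltP (bmnm k) a; first by rewrite mul0r.
have [/lowb ->|lebl] := ltP (bmnm l) b; first by rewrite mulr0.
case/negP: neq; move: leak; rewrite le_eqVlt => /orP[/eqP eak|ltak]; last first.
  by have := ltmc_le_add ltak lebl; rewrite -eab ltxx.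
have ebl : b = l :> 'X_{1..n}.
  by apply/eqP; rewrite -(eqm_add2l a) [X in _ == (X + _)%MM]eak -eab eqxx.
by apply/eqP; congr pair; apply: val_inj.
Qed.

HB.instance Definition _ :=
  GRing.ComUnitRing_isIntegral.Build (mps n R) mps_idomain.

End PowerSeriesIdomain.

Inductive box := Comma | Plus | MinusOnePlus.

Definition box_opt (b : box) : option bool :=
  match b with Comma => None | Plus => Some true | MinusOnePlus => Some false end.
Definition opt_box (o : option bool) : box :=
  match o with
  | None => Comma | Some true => Plus | Some false => MinusOnePlus
  end.
Lemma box_optK : cancel box_opt opt_box. Proof. by case. Qed.
HB.instance Definition _ := Finite.copy box (can_type box_optK).

(** [fill k1 [:: k2; ..; kl] [:: b1; ..; b(l-1)]] is (k1 b1 k2 b2 .. kl). *)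
Fixpoint fill (a : nat) (k : seq nat) (b : seq box) : seq nat :=
  match k, b with
  | c :: k', Comma :: b' => a :: fill c k' b'
  | c :: k', Plus :: b' => fill (a + c)%N k' b'
  | c :: k', MinusOnePlus :: b' => fill (a - 1 + c)%N k' b'
  | _, _ => [:: a]
  end.

Definition wt (k : seq nat) : nat := sumn k.
Definition dep (k : seq nat) : nat := size k.
Definition height (i : nat) (k : seq nat) : nat := count (leq i.+1) k.

(** [hcomp h i] is h_i, for 1 <= i <= r. *)
Definition hcomp r (h : r.-tuple nat) (i : nat) : nat := nth 0%N h i.-1.

Definition multi_indices (k l : nat) r (h : r.-tuple nat) : set (seq nat) :=
  [set s : seq nat | [/\ all (leq 1) s, wt s = k, dep s = l &
     forall i, (1 <= i <= r)%N -> height i s = hcomp h i]]%classic.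

(** F[t][[u_1, .., u_(r+2)]], t being the variable of [{poly F}], and its field
    of fractions, where the negative powers of u_1 in x_i make sense. *)
Notation series F r := (mps r.+2 {poly F}).
Notation fracs F r := {fraction series F r}.
Notation "x %:F" := (@FracField.tofrac _ x) : ring_scope.

Section Main.
Variable F : fieldType.

Definition zbar (n : nat) (q : F) (k : seq nat) : F :=
  \sum_(m : (dep k).-tuple 'I_n
        | sorted gtn (map val m) && all (leq 1) (map val m))
    (q ^+ (\sum_(i < dep k) (nth 0%N k i - 1) * tnth m i)
     / \prod_(i < dep k) (1 - q ^+ tnth m i) ^+ nth 0%N k i).

(** The depth-0 value is never used: see [G]. *)
Definition zbart (n : nat) (q : F) (k : seq nat) : {poly F} :=
  if k is k1 :: k' then
    \sum_(b : (size k').-tuple box)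
      (zbar n q (fill k1 k' b))%:P * 'X^(dep k - dep (fill k1 k' b))
  else 0.

Definition G (n : nat) (q : F) (k l : nat) r (h : r.-tuple nat) : {poly F} :=
  if [&& k == 0%N, l == 0%N & all (pred1 0%N) h] then 1
  else \sum_(s \in multi_indices k l h) zbart n q s.

(** [uvar r i] is u_i, for 1 <= i <= r + 2. *)
Definition uvar r (i : nat) : series F r := mpsX _ (inord i.-1).

(** Subtraction is truncated in the exponents. They are nonnegative whenever
    [G n q k l h] is nonzero, since an entry k_j exceeds exactly
    min(k_j - 1, r) of the numbers 1, .., r. *)
Definition Psi (n : nat) (q : F) r : series F r :=
  mps_sum (fun klh : nat * nat * r.-tuple nat =>
    let: (k, l, h) := klh in
    mpsC _ (G n q k l h)
    * uvar r 1 ^+ (k - l - \sum_(1 <= j < r.+1) hcomp h j)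
    * uvar r 2 ^+ (l - hcomp h 1)
    * (\prod_(1 <= j < r) uvar r j.+2 ^+ (hcomp h j - hcomp h j.+1))
    * uvar r r.+2 ^+ hcomp h r).

Definition cst r (c : F) : fracs F r := (mpsC _ c%:P : series F r)%:F.
Definition tpar r : fracs F r := (mpsC _ 'X : series F r)%:F.

Definition xs r (i : nat) : fracs F r :=
  let u j : fracs F r := (uvar r j)%:F in
  if i == 1%N then u 1 / (1 + u 1)
  else \sum_(i <= j < r.+2)
         (-1) ^+ (j - i) * 'C(j - 2, i - 2)%:R
         * (u j - u r.+2 / u 1 ^+ (r.+2 - j))
       + u r.+2 / (u 1 ^+ (r.+2 - i) * (1 + u 1) ^+ (i - 1)).

(** P^t(T), with T the variable of the polynomial. *)
Definition Pt r (t : fracs F r) : {poly fracs F r} :=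
  'X^(r.+1) - (xs r 1 + t * xs r 2) *: 'X^r
  - t *: \sum_(i < r) (xs r (r.+2 - i) - xs r 1 * xs r (r.+1 - i)) *: 'X^i.

End Main.

(* Main.v *)
From HB Require Import structures.
Require Import Defs.
From mathcomp Require Import all_boot all_order all_algebra.
From mathcomp Require Import ring zify.

(** Put [f_a(m) = q^((a-1)m) / (1-q^m)^a]. Since [f_a f_c = f_(a+c) + f_(a-1+c)],
    filling a box with "+" or "-1+" amounts to letting two summation indices
    coincide, so [zbart n q k] is the sum of [t^e prod_i f_(k_i)(m_i)] over
    [n > m_1 >= .. >= m_l > 0], where [e] is the number of equalities. The
    monomial of [Psi] attached to a multi-index is a product over its entries;
    hence, with [A_m] the generating function of the [f_a(m)], [Psi] is the
    product over [m < n] of [(1 - (t-1) A_m) / (1 - t A_m)]. Summing a geometric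
    series shows that [P^t(T) = T^r (T - x_1) (1 - t A_m)] for [T = 1 - q^m], and
    the factor [T^r (T - x_1)], free of [t], cancels in the quotient. *)

Set Implicit Arguments.
Unset Strict Implicit.
Unset Printing Implicit Defensive.

Import GRing.Theory.
Local Open Scope ring_scope.

(** * Sums over tuples and over boxes *)

Lemma big_tupleS (R : Type) (idx : R) (op : Monoid.com_law idx) (T : finType)
    (l : nat) (P : pred (l.+1.-tuple T)) (f : l.+1.-tuple T -> R) :
  \big[op/idx]_(s | P s) f s =
  \big[op/idx]_(x : T) \big[op/idx]_(s : l.-tuple T | P [tuple of x :: s])
    f [tuple of x :: s].
Proof.
rewrite pair_big_dep /=.
rewrite (reindex (fun p : T * l.-tuple T => [tuple of p.1 :: p.2])) //=.
exists (fun s => (thead s, [tuple of behead s])) => [[x s]|s] _ /=.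
  by congr pair; apply: val_inj.
by rewrite -tuple_eta.
Qed.

Lemma big_box (V : nmodType) (f : box -> V) :
  \sum_(b : box) f b = f Comma + f Plus + f MinusOnePlus.
Proof.
rewrite (bigD1 Comma) // (bigD1 Plus) // (bigD1 MinusOnePlus) //=.
by rewrite big_pred0 ?addr0 ?addrA // => -[].
Qed.

(** * Nested sums with strict and with weak inequalities *)

Section HarmonicSums.
Variables (F : fieldType) (q : F).

Definition hterm (a m : nat) : F := q ^+ ((a - 1) * m) / (1 - q ^+ m) ^+ a.

(** The entry [a] enters geometrically, which makes the generating function over [a] rational. *)
Lemma hterm_geom a m :
  hterm a.+1 m = (1 - q ^+ m)^-1 * (q ^+ m / (1 - q ^+ m)) ^+ a.
Proof.
by rewrite /hterm subn1 /= exprMn exprVn exprS invfM mulnC exprM mulrCA.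
Qed.

(* This is why filling boxes with "+" and "-1+" turns strict inequalities
   between the summation indices into weak ones. *)
Lemma htermM a c m : (0 < a)%N -> (0 < c)%N -> q ^+ m != 1 ->
  hterm a m * hterm c m = hterm (a + c) m + hterm (a - 1 + c) m.
Proof.
case: a c => [//|a] [//|c] _ _ qm1; rewrite subn1 addSn !addnS !hterm_geom.
have nz : 1 - q ^+ m != 0 by rewrite subr_eq0 eq_sym.
rewrite exprS exprD; set y := q ^+ m in nz *; set z := y / _.
have -> : z = (1 - y)^-1 - 1 by rewrite /z; field.
by move: (_ ^+ a) (_ ^+ c) => A B; ring.
Qed.

Fixpoint hsum (n : nat) (k : seq nat) : F :=
  if k is a :: k' then \sum_(1 <= j < n) hterm a j * hsum j k' else 1.

Lemma hsumS n a k : (0 < n)%N ->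
  hsum n.+1 (a :: k) = hsum n (a :: k) + hterm a n * hsum n k.
Proof. by move=> n0; rewrite /= big_nat_recr. Qed.

(** The index type ['I_n] stays fixed while the bound [N] varies, so that the induction on [k] can
    lower the bound to the index just chosen. *)
Lemma hsum_tuple n N (k : seq nat) : (N <= n)%N ->
  \sum_(m : (size k).-tuple 'I_n
        | path gtn N (map val m) && all (leq 1) (map val m))
    \prod_(i < size k) hterm (nth 0%N k i) (tnth m i) = hsum N k.
Proof.
elim: k N => [|a k IH] N leNn /=.
  rewrite (big_pred1 [tuple]) ?big_ord0 // => s /=.
  by rewrite tuple0 /= eqxx.
rewrite big_tupleS /=.
transitivity (\sum_(i < n | (0 < i < N)%N) hterm a i * hsum i k).
  rewrite [RHS]big_mkcond; apply: eq_bigr => i _.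
  have [/andP[i0 iN]|ni] := ifP; last first.
    by apply: big_pred0 => s; rewrite andbACA -(andbC (0 < i)%N) ni.
  rewrite -IH ?(ltnW (ltn_ord _)) // big_distrr /=.
  apply: eq_big => [s|s _]; first by rewrite iN i0.
  rewrite big_ord_recl /=; congr (_ * _).
  by apply: eq_bigr => j _; rewrite tnthS.
rewrite -(big_mkord (fun i => (0 < i < N)%N) (fun i => hterm a i * hsum i k)).
rewrite (big_cat_nat _ leNn) //= [X in _ + X]big_nat_cond.
rewrite [X in _ + X]big_pred0; last first.
  by move=> i; rewrite [(i < N)%N]ltnNge; case: (N <= i)%N; rewrite /= ?andbF.
rewrite addr0.
(* Ordinals start at 0 but [hsum] sums from 1: for positive [N] the term at 0 is split off, and its
   condition is false. *)
case: N leNn => [|N] _; first by rewrite !big_geq.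
rewrite big_ltn_cond //= big_nat_cond [RHS]big_nat_cond.
by apply: eq_bigl => i; case: (0 < i)%N => //=; case: (i < N.+1)%N.
Qed.

Lemma zbar_hsum n k : zbar n q k = hsum n k.
Proof.
rewrite -(hsum_tuple k (leqnn n)) /zbar /dep; apply: eq_big => [m|m _].
  case: k m => [|a k] m; first by rewrite tuple0.
  by rewrite (tuple_eta m) /= ltn_ord.
rewrite big_split /= prodfV; congr (_ / _).
by rewrite expr_sum.
Qed.

(** Differs from [zbart] only at the empty multi-index, where the value 1 matches the convention for
    [G] at zero and starts the recurrence. *)
Definition zt (n : nat) (k : seq nat) : {poly F} :=
  if k is [::] then 1 else zbart n q k.
Arguments zt : simpl never.

Lemma zt_fill n a k :
  zt n (a :: k) = \sum_(b : (size k).-tuple box)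
    (hsum n (fill a k b))%:P * 'X^((size k).+1 - size (fill a k b)).
Proof. by apply: eq_bigr => b _; rewrite zbar_hsum. Qed.

Lemma size_fill a k (b : seq box) : (size (fill a k b) <= (size k).+1)%N.
Proof.
elim: k a b => [|c k IH] a [|[] b] //=; first exact: IH; exact: leqW (IH _ _).
Qed.

(** Split on the first box: a comma keeps [a] apart, and either merge shortens the result by one
    entry, at the cost of one factor t. *)
Lemma zt_cons2 n a c k :
  zt n [:: a, c & k] =
    \sum_(b : (size k).-tuple box)
      (hsum n (a :: fill c k b))%:P * 'X^((size k).+1 - size (fill c k b))
    + 'X * (zt n (a + c :: k)%N + zt n (a - 1 + c :: k)%N).
Proof.
rewrite !zt_fill /= big_tupleS big_box /= -addrA mulrDr !big_distrr /=.
by congr (_ + (_ + _)); apply: eq_bigr => b _;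
  rewrite subSn ?size_fill // exprS mulrCA.
Qed.

(** Only terms with m_1 = n survive in the difference. If m_2 < n, the rest gives [zt n k]; if m_2 =
    n, it gives [zt n.+1 k - zt n k] with an extra factor t. *)
Lemma zt_recl n a k : (0 < n)%N -> q ^+ n != 1 -> (0 < a)%N -> all (leq 1) k ->
  zt n.+1 (a :: k) - zt n (a :: k) =
    (hterm a n)%:P * ('X * zt n.+1 k + (1 - 'X) * zt n k).
Proof.
move=> n0 qn1; elim: k a => [|c k IH] a a0.
  move=> _; rewrite !mulr1 [X in _ * X]addrC subrK mulr1 !zt_fill -sumrB.
  rewrite (big_pred1 [tuple]) => [|s]; last by rewrite [s]tuple0 /= eqxx.
  by rewrite /= big_nat_recr //= !expr0 !mulr1 polyCD addrC addKr.
case/andP => c0 kp.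
have hs b : hsum n.+1 (a :: fill c k b) = hsum n (a :: fill c k b)
    + hterm a n * hsum n (fill c k b) by rewrite hsumS.
rewrite !zt_cons2.
under eq_bigr do rewrite hs polyCD mulrDl polyCM -mulrA.
rewrite big_split /= -big_distrr /= -zt_fill.
have E x : (0 < x)%N -> zt n.+1 (x :: k) = zt n (x :: k) +
   (hterm x n)%:P * ('X * zt n.+1 k + (1 - 'X) * zt n k).
  by move=> x0; rewrite -IH // addrC subrK.
rewrite !E ?addn_gt0 ?a0 ?c0 ?orbT //.
set S := \sum_(_ | _) _; set e := _ + (1 - 'X) * _.
(* Both merges carry the same factor t [e], so by [htermM] their sum is the product of the two
   separate terms. *)
have -> : (hterm (a + c) n)%:P = (hterm a n)%:P * (hterm c n)%:P
    - (hterm (a - 1 + c) n)%:P.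
  by rewrite -polyCM htermM // polyCD addrK.
by ring.
Qed.

End HarmonicSums.

(** * Polynomials as power series, and order of vanishing *)

Section PowerSeries.
Variables (n : nat) (R : comNzRingType).
Implicit Types (p : {mpoly R[n]}) (f g : mps n R) (m : 'X_{1..n}).

Definition mps_of p : mps n R := MPS (fun m => p@_m).

Lemma mps_of_is_zmod_morphism : zmod_morphism mps_of.
Proof. by move=> p p'; apply: mpsP => m /=; rewrite mcoeffB. Qed.
Lemma mps_of_is_monoid_morphism : monoid_morphism mps_of.
Proof.
split=> [|p p']; apply: mpsP => m /=; last by rewrite mcoeffM.
by rewrite mcoeff1; case: (m == 0%MM).
Qed.
HB.instance Definition _ := GRing.isZmodMorphism.Build {mpoly R[n]} (mps n R)
  mps_of mps_of_is_zmod_morphism.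
HB.instance Definition _ := GRing.isMonoidMorphism.Build {mpoly R[n]} (mps n R)
  mps_of mps_of_is_monoid_morphism.

Lemma mpsCE c : mpsC n c = mps_of c%:MP.
Proof.
by apply: mpsP => m /=; rewrite mcoeffC mulr_natr; case: (m == 0%MM).
Qed.

Lemma mpsC_is_zmod_morphism : zmod_morphism (mpsC n (R := R)).
Proof. by move=> c d; rewrite !mpsCE !rmorphB. Qed.
Lemma mpsC_is_monoid_morphism : monoid_morphism (mpsC n (R := R)).
Proof. by split=> [|c d]; rewrite !mpsCE ?rmorph1 ?rmorphM. Qed.
HB.instance Definition _ := GRing.isZmodMorphism.Build R (mps n R)
  (@mpsC n R) mpsC_is_zmod_morphism.
HB.instance Definition _ := GRing.isMonoidMorphism.Build R (mps n R)
  (@mpsC n R) mpsC_is_monoid_morphism.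

Lemma mps_ofZ c p : mps_of (c *: p) = mpsC n c * mps_of p.
Proof. by rewrite -mul_mpolyC mpsCE rmorphM. Qed.

Lemma mpsXE i : mpsX R i = mps_of 'X_i.
Proof. by apply: mpsP => m /=; rewrite mcoeffX eq_sym. Qed.

(** [low d f]: the series [f] vanishes modulo the [d]-th power of the ideal
    generated by the variables. *)
Definition low d f := forall m, (mdeg m < d)%N -> mpsc f m = 0.

Lemma lowD d f g : low d f -> low d g -> low d (f + g).
Proof. by move=> lf lg m lt_m; rewrite /= lf ?lg ?addr0. Qed.

Lemma lowN d f : low d f -> low d (- f).
Proof. by move=> lf m lt_m; rewrite /= lf ?oppr0. Qed.

Lemma lowB d f g : low d f -> low d g -> low d (f - g).
Proof. by move=> lf lg; apply/lowD/lowN. Qed.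

Lemma lowM d f g : low d f -> low d (g * f).
Proof.
move=> lf m lt_m; apply: big1 => k /eqP em; rewrite (lf k.2) ?mulr0 //.
by apply: leq_ltn_trans lt_m; rewrite [in leqRHS]em mdegD leq_addl.
Qed.

Lemma lowX d m : (d <= mdeg m)%N -> low d (mps_of 'X_[m]).
Proof.
move=> le_d k lt_k /=; rewrite mcoeffX; case: eqP => // emk.
by move: lt_k; rewrite -emk ltnNge le_d.
Qed.

Lemma low_eq0 f : (forall d, low d f) -> f = 0.
Proof. by move=> lf; apply: mpsP => m; apply: (lf (mdeg m).+1). Qed.

End PowerSeries.

(** * Finite lists of words with bounded length and entries *)

Fixpoint words (N L : nat) : seq (seq nat) :=
  if L is L'.+1 then [::] :: [seq a :: s | a <- iota 1 N, s <- words N L']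
  else [:: [::]].

Lemma mem_words N L s :
  (s \in words N L) = (size s <= L)%N && all (fun a => 0 < a <= N)%N s.
Proof.
elim: L s => [|L IH] [|a s]; rewrite ?inE //=.
rewrite ltnS andbCA -IH.
apply/allpairsP/idP => [[[b w] /= [bi wi [-> ->]]]|].
  by move: bi; rewrite mem_iota wi add1n ltnS => ->.
move=> /andP[aN ws]; exists (a, s).
by rewrite /= ws mem_iota add1n ltnS aN.
Qed.

Lemma uniq_words N L : uniq (words N L).
Proof.
elim: L => [|L IH] //=; apply/andP; split.
  by apply/negP => /allpairsP[[a s] /= [_ _]].
apply: allpairs_uniq => //; first exact: iota_uniq.
by move=> [a s] [b w] _ _ /= [-> ->].
Qed.

(** * Generating series over multi-indices and their truncations *)

Section Monomials.
Variable r : nat.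

(** The monomial contributed to [Psi] by an entry of a multi-index. *)
Definition emon (a : nat) : 'X_{1..r.+2} :=
  if (a <= r)%N then U_(inord a)%MM
  else (U_(inord 0) *+ (a - r.+1) + U_(inord r.+1))%MM.
Definition smon (s : seq nat) : 'X_{1..r.+2} := (\sum_(a <- s) emon a)%MM.

Lemma smon_cons a s : smon (a :: s) = (emon a + smon s)%MM.
Proof. by rewrite /smon big_cons. Qed.

Lemma leq_mdeg_emon a : (a <= mdeg (emon a) + r)%N.
Proof.
rewrite /emon; case: (leqP a r) => [le_ar|lt_ra].
  exact: leq_trans le_ar (leq_addl _ _).
by rewrite mdegD mdegMn !mdeg1 mul1n addn1 addSnnS subnK.
Qed.

Lemma mdeg_emon_gt0 a : (0 < mdeg (emon a))%N.
Proof. by rewrite /emon; case: ifP => _; rewrite ?mdegD mdeg1 // addn1. Qed.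

(** Every entry adds at least 1 to the degree, and an entry a > r adds a - r. Hence only finitely
    many multi-indices share a monomial. *)
Lemma smon_bounds s : (size s <= mdeg (smon s))%N
  /\ all (fun a => a <= mdeg (smon s) + r)%N s.
Proof.
elim: s => [|a s [IHs IHa]] //=; rewrite smon_cons mdegD.
split; first by rewrite -add1n leq_add ?mdeg_emon_gt0.
rewrite addnAC (leq_trans (leq_mdeg_emon a)) ?leq_addr //=.
apply: sub_all IHa => b /leq_trans; apply.
by rewrite addnAC leq_add2r leq_addl.
Qed.

Variable R : comNzRingType.
Implicit Types c d e : seq nat -> R.

Definition gftrunc c N L : {mpoly R[r.+2]} :=
  \sum_(s <- words N L) c s *: 'X_[smon s].

(** The sum of [c s] times the monomial of [s] over all multi-indices; by [smon_bounds] the list of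
    words used at [m] misses none with that monomial. *)
Definition gf c : mps r.+2 R := MPS (fun m =>
  \sum_(s <- words (mdeg m + r) (mdeg m) | smon s == m) c s).

Lemma sum_words m c N L : (mdeg m + r <= N)%N -> (mdeg m <= L)%N ->
  \sum_(s <- words N L | smon s == m) c s = mpsc (gf c) m.
Proof.
move=> leN leL; rewrite /= -big_filter -[RHS]big_filter; apply: perm_big.
apply: uniq_perm; rewrite ?filter_uniq ?uniq_words // => s.
rewrite !mem_filter; case: eqP => //= es; rewrite !mem_words.
have [ss sa] := smon_bounds s; rewrite es in ss sa.
rewrite ss (leq_trans ss leL) /=; apply: eq_in_all => a /(allP sa) aN.
by rewrite aN (leq_trans aN).
Qed.

Lemma gf_trunc c (d N L : nat) : (d + r <= N)%N -> (d <= L)%N ->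
  low d (gf c - mps_of (gftrunc c N L)).
Proof.
move=> leN leL m lt_m.
have leN' : (mdeg m + r <= N)%N.
  by apply: leq_trans leN; rewrite leq_add2r ltnW.
have leL' : (mdeg m <= L)%N by apply: leq_trans leL; apply: ltnW.
rewrite /= -[X in X - _]/(mpsc (gf c) m) -(sum_words c leN' leL').
rewrite /gftrunc raddf_sum /= big_mkcond -sumrB big1 // => s _.
by rewrite mcoeffZ mcoeffX; case: eqP; rewrite ?mulr1 ?mulr0 subrr.
Qed.

(** The empty words cancel, and any other word splits into head and tail, on which [smon] is
    additive; the length bound therefore drops by one on the right. *)
Lemma gftrunc_recl c d e (f : nat -> R) N L :
  c [::] = d [::] ->
  (forall a s, (0 < a)%N -> all (leq 1) s ->
     c (a :: s) - d (a :: s) = f a * e s) ->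
  gftrunc c N L.+1 - gftrunc d N L.+1 =
    (\sum_(1 <= a < N.+1) f a *: 'X_[emon a]) * gftrunc e N L.
Proof.
move=> e0 ecd; rewrite /gftrunc /= !big_cons e0 opprD addrACA subrr add0r -sumrB.
rewrite big_allpairs_dep /= big_distrl /= /index_iota subn1.
apply: eq_big_seq => a; rewrite mem_iota => /andP[a0 _].
rewrite big_distrr /=; apply: eq_big_seq => s; rewrite mem_words => /andP[_ sa].
rewrite -scalerBl ecd //; last by apply: sub_all sa => b /andP[].
by rewrite smon_cons mpolyXD -scalerAl -scalerAr scalerA.
Qed.

End Monomials.

(** * The monomial of [Psi] as a product over entries *)

Section Exponents.
Variable r : nat.
Hypothesis r_gt0 : (0 < r)%N.

(** Taking [h] as a function rather than a tuple lets heights be added pointwise. *)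
Definition psi_expo (k l : nat) (h : nat -> nat) : 'X_{1..r.+2} :=
  (U_(inord 0) *+ (k - l - \sum_(1 <= j < r.+1) h j)
   + U_(inord 1) *+ (l - h 1)
   + \sum_(1 <= j < r) U_(inord j.+1) *+ (h j - h j.+1)
   + U_(inord r.+1) *+ h r)%MM.

Lemma eq_psi_expo k l h h' : (forall i, 1 <= i <= r -> h i = h' i)%N ->
  psi_expo k l h = psi_expo k l h'.
Proof.
move=> eh; rewrite /psi_expo !eh ?r_gt0 ?leqnn //.
rewrite (@eq_big_nat _ _ _ 1 r.+1 h h' eh); congr (_ + _ + _)%MM.
by apply: eq_big_nat => j /andP[j0 jr]; rewrite !eh ?j0 //= ltnW.
Qed.

(** The inequalities guarantee that no truncated subtraction loses anything, so each exponent is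
    additive. *)
Lemma psi_expoD k l h k' l' h' :
  (l + \sum_(1 <= j < r.+1) h j <= k)%N ->
  (l' + \sum_(1 <= j < r.+1) h' j <= k')%N ->
  (h 1 <= l)%N -> (h' 1 <= l')%N ->
  (forall j, h j.+1 <= h j)%N -> (forall j, h' j.+1 <= h' j)%N ->
  psi_expo (k + k') (l + l') (fun j => h j + h' j)%N =
  (psi_expo k l h + psi_expo k' l' h')%MM.
Proof.
move=> lk lk' hl hl' dh dh'; apply/mnmP => i.
rewrite !mnmDE !mulmnE !mnm_sumE.
have -> : (k + k' - (l + l') - \sum_(1 <= j < r.+1) (h j + h' j) =
  (k - l - \sum_(1 <= j < r.+1) h j) + (k' - l' - \sum_(1 <= j < r.+1) h' j))%N.
  by rewrite big_split /=; lia.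
have -> : (l + l' - (h 1 + h' 1) = (l - h 1) + (l' - h' 1))%N by lia.
have -> : (\sum_(1 <= j < r)
    (U_(inord j.+1) *+ (h j + h' j - (h j.+1 + h' j.+1)))%MM i =
   \sum_(1 <= j < r) (U_(inord j.+1) *+ (h j - h j.+1))%MM i +
   \sum_(1 <= j < r) (U_(inord j.+1) *+ (h' j - h' j.+1))%MM i)%N.
  rewrite -big_split /=; apply: eq_bigr => j _; rewrite !mulmnE -mulnDr.
  by congr (_ * _)%N; have := dh j; have := dh' j; lia.
rewrite !mulnDr [RHS]addnACA; congr (_ + _)%N.
by rewrite [RHS]addnACA; congr (_ + _)%N; rewrite addnACA.
Qed.

Lemma sum_ltn_nat a : (\sum_(1 <= j < r.+1) (j < a) = minn a.-1 r)%N.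
Proof.
elim: r => [|n IH]; first by rewrite big_geq // minn0.
by rewrite big_nat_recr //= IH; case: ltnP; lia.
Qed.

(** The heights of a single entry are 1 for j < a and 0 afterwards. Their drop selects the variable:
    u_2 if a = 1, u_(a+1) if 2 <= a <= r, and u_(r+2) with a power of u_1 if a > r. *)
Lemma psi_expo1 a : (0 < a)%N ->
  psi_expo a 1 (fun j => (j < a)%N) = emon r a.
Proof.
move=> a0; rewrite /psi_expo sum_ltn_nat /emon.
have sum0 : (forall j, 1 <= j < r -> j.+1 != a)%N ->
    (\sum_(1 <= j < r) U_(inord j.+1) *+ ((j < a) - (j.+1 < a)) = 0
      :> 'X_{1..r.+2})%MM.
  move=> ja; rewrite big_nat big1 // => j /ja nja.
  by have -> : ((j < a) - (j.+1 < a) = 0)%N by lia.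
case: (leqP a r) => [le_ar|lt_ra]; last first.
  have -> : minn a.-1 r = r by lia.
  have -> : (1 < a)%N by lia.
  rewrite sum0; last by move=> j; lia.
  by rewrite subnn mulm0n mulm1n !addm0 -subnDA add1n.
have -> : (minn a.-1 r = a - 1)%N by lia.
rewrite subnn mulm0n add0m mulm0n addm0.
case: (ltnP 1 a) => a1.
  rewrite mulm0n add0m (bigD1_seq a.-1) ?iota_uniq //=; last first.
    by rewrite mem_index_iota; lia.
  have -> : ((a.-1 < a) - (a.-1.+1 < a) = 1)%N by lia.
  rewrite mulm1n prednK // big1 ?addm0 // => j ja.
  by have -> : ((j < a) - (j.+1 < a) = 0)%N by lia.
have -> : a = 1%N by lia.
rewrite mulm1n big_nat big1 ?addm0 // => j /andP[j0 _].
by have -> : ((j < 1) - (j.+1 < 1) = 0)%N by lia.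
Qed.

Lemma height_antitone s j : (height j.+1 s <= height j s)%N.
Proof. by apply: sub_count => a /=; apply: leqW. Qed.

Lemma wt_bound s : all (leq 1) s ->
  (dep s + \sum_(1 <= j < r.+1) height j s <= wt s)%N.
Proof.
elim: s => [|a s IH] /=; first by rewrite big1.
case/andP => a0 /IH; rewrite big_split /= sum_ltn_nat /dep /wt /=; lia.
Qed.

Lemma smonE s : all (leq 1) s ->
  smon r s = psi_expo (wt s) (dep s) (fun j => height j s).
Proof.
elim: s => [|a s IH] /=.
  move=> _; rewrite /smon big_nil /psi_expo /wt /dep /= !sub0n !mulm0n.
  by rewrite big1 ?addm0.
case/andP => a0 sp; rewrite smon_cons IH // -psi_expo1 //.
rewrite -psi_expoD //.
- by rewrite sum_ltn_nat; lia.
- exact: wt_bound.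
- exact: leq_b1.
- exact: count_size.
- by move=> j; case: ltnP => // /ltnW ->.
- exact: height_antitone.
Qed.

End Exponents.

(** * [Psi] as a generating series over multi-indices *)

Section PsiGf.
Variables (F : fieldType) (q : F) (n r : nat).
Hypothesis r_gt0 : (0 < r)%N.

Definition stat (s : seq nat) : nat * nat * r.-tuple nat :=
  (wt s, dep s, [tuple height i.+1 s | i < r]).

Lemma multi_indicesP k l (h : r.-tuple nat) s :
  multi_indices k l h s <-> all (leq 1) s /\ stat s = (k, l, h).
Proof.
rewrite /stat; split=> [[sp <- <- hh]|[sp [<- <- <-]]].
  split=> //; congr (_, _, _); apply: eq_from_tnth => i.
  by rewrite (tnth_nth 0%N h) tnth_mktuple hh //= ltn_ord.
split=> // [[|i]] //= lt_ir.
by rewrite /hcomp /= (nth_map (Ordinal lt_ir)) ?size_enum_ord // nth_enum_ord.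
Qed.

Lemma smon_multi_indices k l (h : r.-tuple nat) s :
  multi_indices k l h s -> smon r s = psi_expo r k l (hcomp h).
Proof.
case=> sp <- <- hh; rewrite smonE //; exact: eq_psi_expo.
Qed.

(** The exceptional value of [G] at zero becomes the contribution of the empty multi-index. *)
Lemma G_zt k l (h : r.-tuple nat) :
  G n q k l h = \sum_(s \in multi_indices k l h) zt q n s.
Proof.
rewrite /G; case: ifP => [/and3P[/eqP-> /eqP-> /all_nthP h0]|nz].
  rewrite (_ : multi_indices 0 0 h = [set [::]]%classic) ?fsbig_set1 //.
  apply/seteqP; split=> s /=; first by case=> _ _ /size0nil.
  move=> ->; split=> // [[|i]] //= lt_ir; rewrite /hcomp /height /=.
  by apply/esym/eqP/h0; rewrite size_tuple.
apply: eq_fsbigr => s /set_mem[_ ws ds hs]; case: s ws ds hs => //.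
rewrite /wt /dep /= => e0 e0' hh; case/negP: nz; rewrite -e0 -e0' /=.
apply/(all_nthP 0%N) => i; rewrite size_tuple => lt_ir.
by have := hh i.+1 lt_ir; rewrite /hcomp /= => <-.
Qed.

Lemma psi_termE c k l (h : nat -> nat) m :
  mpsc (mpsC _ c * uvar F r 1 ^+ (k - l - \sum_(1 <= j < r.+1) h j)
    * uvar F r 2 ^+ (l - h 1%N)
    * (\prod_(1 <= j < r) uvar F r j.+2 ^+ (h j - h j.+1))
    * uvar F r r.+2 ^+ h r) m = if psi_expo r k l h == m then c else 0.
Proof.
under [X in _ * X * _]eq_bigr do rewrite /uvar mpsXE -rmorphXn /= mpolyXn.
rewrite /uvar !mpsXE mpsCE -rmorph_prod -!rmorphXn -!rmorphM /=.
rewrite !mpolyXn -(big_map _ xpredT (fun m => 'X_[m])) mpolyX_prod big_map.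
rewrite -!mulrA -!mpolyXD mcoeffCM mcoeffX !addmA.
by rewrite -/(psi_expo r k l h); case: eqP; rewrite ?mulr1 ?mulr0.
Qed.

(** At a fixed monomial only a finite list of multi-indices matters; sorting that list by [stat]
    recovers the index sets in [Psi]. *)
Lemma Psi_gf : Psi n q r = gf r (zt q n).
Proof.
apply: mpsP => m; rewrite /Psi /=.
set W := words _ _.
pose Wm := [seq s <- W | smon r s == m].
have WmP s : s \in Wm -> multi_indices (wt s) (dep s) (stat s).2 s
    /\ smon r s = m.
  rewrite mem_filter mem_words => /andP[/eqP <- /andP[_ sp]]; split=> //.
  by apply/multi_indicesP; split=> //; apply: sub_all sp => a /andP[].
have in_Wm k l h s : multi_indices k l h s -> smon r s = m ->
    s \in [seq s <- Wm | stat s == (k, l, h)].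
  move=> /multi_indicesP[sp es] sm; rewrite !mem_filter es sm !eqxx /=.
  rewrite mem_words; have [] := smon_bounds r s; rewrite sm => -> /=.
  by move=> /allP sb; apply/allP => a sa; rewrite sb // (allP sp).
transitivity (\sum_(x \in [set: nat * nat * r.-tuple nat]%classic)
   \sum_(s <- Wm | stat s == x) zt q n s).
  apply: eq_fsbigr => -[[k l] h] _; rewrite psi_termE.
  case: eqP => [em|nem]; last first.
    rewrite big_seq_cond big1 // => s /andP[/WmP[[sp _ _ _] sm] /eqP es].
    case: nem; rewrite -sm; apply/esym/smon_multi_indices.
    exact/multi_indicesP.
  rewrite G_zt (_ : multi_indices k l h =
    [set` [seq s <- Wm | stat s == (k, l, h)]]%classic).
    rewrite -fsbig_seq ?big_filter //.
    by rewrite !filter_uniq ?uniq_words.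
  apply/seteqP; split=> s /= sI.
    by apply: in_Wm => //; rewrite (smon_multi_indices sI).
  move: sI; rewrite mem_filter => /andP[/eqP es /WmP[sI _]].
  by apply/multi_indicesP; split=> //; case: sI.
(* Triples outside [U] have an empty inner sum, so the sum over all triples becomes finite and can
   be exchanged. *)
pose U := undup [seq stat s | s <- Wm].
rewrite -(@fsbig_widen _ _ _ _ [set` U]%classic) //; last first.
  move=> x [_ /= xU]; rewrite big_seq_cond big1 // => s /andP[sW /eqP es].
  by case: xU; rewrite mem_undup -es map_f.
rewrite -fsbig_seq ?undup_uniq // (exchange_big_dep xpredT) //= -[RHS]big_filter.
apply: eq_big_seq => s sW; rewrite big_mkcond (bigD1_seq (stat s)) /=.
- by rewrite eqxx big1 ?addr0 // => x; rewrite eq_sym => /negPf ->.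
- by rewrite mem_undup map_f.
- exact: undup_uniq.
Qed.

End PsiGf.

(** * Evaluation of P^t over a field *)

Section FieldIdentities.
Variable K : fieldType.

(** The term with x_2 completes the first sum; once x_(r+2) is split off, it is T times the sum that
    [c] multiplies. *)
Lemma horner_telescope (x : nat -> K) (c T : K) r :
  x 2%N * T ^+ r + \sum_(i < r) (x (r.+2 - i)%N - c * x (r.+1 - i)%N) * T ^+ i
  = (T - c) * \sum_(i < r) x (r.+1 - i)%N * T ^+ i + x r.+2.
Proof.
under eq_bigr do rewrite mulrBl -mulrA.
rewrite sumrB -big_distrr /= mulrBl addrA [RHS]addrAC; congr (_ - _).
transitivity (\sum_(i < r.+1) x (r.+2 - i)%N * T ^+ i).
  by rewrite big_ord_recr /= (_ : r.+2 - r = 2)%N 1?addrC //; lia.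
rewrite big_ord_recl /= subn0 expr0 mulr1 addrC big_distrr /=.
by congr (_ + _); apply: eq_bigr => i _; rewrite /bump add1n subSS exprS mulrCA.
Qed.

Lemma horner_rev (x : nat -> K) (T : K) r : T != 0 ->
  \sum_(i < r) x (r.+1 - i)%N * T ^+ i =
  T ^+ r * \sum_(i < r) x i.+2 * T^-1 ^+ i.+1.
Proof.
move=> T0; rewrite (reindex_inj rev_ord_inj) big_distrr /=.
apply: eq_bigr => i _; rewrite mulrCA; congr (x _ * _).
  by have := ltn_ord i; rewrite /=; lia.
by rewrite /= exprB ?unitfE ?exprVn.
Qed.

Lemma sum_nat_shift2 (f : nat -> K) i r :
  \sum_(i.+2 <= j < r.+2) f j = \sum_(j < r | (i <= j)%N) f j.+2.
Proof. by rewrite 2!big_add1 big_geq_mkord. Qed.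

(** After the sums are exchanged, the inner one expands (X - 1)^j. This removes the alternating
    binomials from the x_i. *)
Lemma binomial_inversion (v : nat -> K) (X : K) r :
  \sum_(i < r) (\sum_(j < r | (i <= j)%N) (-1) ^+ (j - i) * 'C(j, i)%:R * v j)
     * X ^+ i.+1 = \sum_(j < r) v j * (X * (X - 1) ^+ j).
Proof.
under eq_bigr do rewrite big_distrl /=.
rewrite (exchange_big_dep xpredT) //=; apply: eq_bigr => j _.
rewrite [X - 1]addrC exprDn !big_distrr /=.
rewrite (big_ord_widen_cond r xpredT (fun i => v j * (X *
  ((-1) ^+ (j - i) * X ^+ i *+ 'C(j, i))))) ?ltn_ord //=.
by apply: eq_bigr => i _; rewrite exprS -mulr_natr; ring.
Qed.

(** A geometric sum of ratio u a, scaled by u^-r; it evaluates the parts of the x_i with negative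
    powers of u_1. *)
Lemma geometric_inv (a u : K) r : u != 0 ->
  (\sum_(i < r) a ^+ i / u ^+ (r - i)) * (1 - u * a) = u ^- r - a ^+ r.
Proof.
move=> u0; transitivity (u ^- r * ((1 - u * a) * \sum_(i < r) (u * a) ^+ i)).
  rewrite mulrC mulrCA; congr (_ * _); rewrite big_distrr /=.
  apply: eq_bigr => i _.
  rewrite exprMn exprB ?unitfE // 1?ltnW //; field.
  by rewrite !expf_neq0.
rewrite -opprB mulNr -subrX1 opprB mulrBr mulr1 exprMn mulrA mulVf ?mul1r //.
by rewrite expf_neq0.
Qed.

(** With [T^-1] for X, the quotient B / D is the generating function A_m. Telescoping extracts T -
    x_1; what remains is to evaluate the sum of the x_(i+2) T^-(i+1). *)
Lemma horner_factor (u x : nat -> K) (t T : K) r :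
  x 1%N = u 1%N / (1 + u 1%N) ->
  (forall i,
     x i.+2 = \sum_(i.+2 <= j < r.+2) (-1) ^+ (j - i.+2) * 'C(j - 2, i)%:R
         * (u j - u r.+2 / u 1%N ^+ (r.+2 - j))
       + u r.+2 / (u 1%N ^+ (r - i) * (1 + u 1%N) ^+ i.+1)) ->
  u 1%N != 0 -> 1 + u 1%N != 0 -> T != 0 -> T * (1 + u 1%N) - u 1%N != 0 ->
  let D := 1 - u 1%N * (T^-1 - 1) in
  let B := D * (\sum_(j < r) u j.+2 * (T^-1 * (T^-1 - 1) ^+ j))
    + u r.+2 * (T^-1 * (T^-1 - 1) ^+ r) in
  (T ^+ r.+1 - (x 1%N + t * x 2%N) * T ^+ r
    - t * \sum_(i < r) (x (r.+2 - i)%N - x 1%N * x (r.+1 - i)%N) * T ^+ i) * D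
  = T ^+ r * (T - x 1%N) * (D - t * B).
Proof.
move=> x1 xE u0 u1 T0 TD D B.
have xr : x r.+2 = u r.+2 / (1 + u 1%N) ^+ r.+1.
  by rewrite xE // big_geq // add0r subnn expr0 mul1r.
(* The identity left after telescoping; its last term comes from the x_(r+2) split off there. *)
have sumD : D * (\sum_(i < r) x i.+2 * T^-1 ^+ i.+1) + x r.+2 * T^-1 ^+ r *
    (D / (T - x 1%N)) = B; last first.
  transitivity ((T ^+ r * (T - x 1%N) - t * (x 2%N * T ^+ r +
     \sum_(i < r) (x (r.+2 - i)%N - x 1%N * x (r.+1 - i)%N) * T ^+ i)) * D).
    by rewrite exprS; ring.
  rewrite horner_telescope horner_rev // -sumD x1; set S := \sum_(i < r) _.
  rewrite exprVn; field.
  by rewrite expf_neq0 ?u1 ?TD.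
rewrite x1 xr /B; set w := u r.+2; set z := T^-1 / (1 + u 1%N).
have -> : D / (T - u 1%N / (1 + u 1%N)) = T^-1 * (1 + u 1%N).
  by rewrite /D; field; rewrite T0 u1 TD.
have D0 : (1 - u 1%N * z) * (1 + u 1%N) = D.
  by rewrite /D /z; field; rewrite ?T0 ?u1.
have := geometric_inv (T^-1 - 1) r u0; rewrite -/D.
have := geometric_inv z r u0.
(* [g2] collects the subtracted terms u_(r+2) / u_1^(r+2-j) after binomial inversion, and [g1] the
   final summands of the x_i, whose ratio involves [z]. *)
set g1 := \sum_(i < r) _; set g2 := \sum_(i < r) _ => e1 e2.
have -> : \sum_(i < r) x i.+2 * T^-1 ^+ i.+1 =
   \sum_(j < r) u j.+2 * (T^-1 * (T^-1 - 1) ^+ j) - w * T^-1 * g2 + w * z * g1.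
  under eq_bigr do rewrite xE mulrDl sum_nat_shift2.
  rewrite big_split /=; congr (_ + _).
    under eq_bigr do under eq_bigr do rewrite !subSS subn0.
    rewrite (binomial_inversion (fun j => u j.+2 - w / u 1%N ^+ (r - j))).
    rewrite big_distrr -sumrB; apply: eq_bigr => i _ /=.
    by ring.
  rewrite big_distrr; apply: eq_bigr => i _ /=.
  rewrite -/w /z !exprMn !exprVn !exprS; field.
  by rewrite ?expf_neq0 ?T0 ?u1.
have -> : w / (1 + u 1%N) ^+ r.+1 * T^-1 ^+ r * (T^-1 * (1 + u 1%N)) =
  w * T^-1 * z ^+ r.
  by rewrite /z exprMn !exprVn exprS; field; rewrite ?expf_neq0 ?T0 ?u1.
set S := \sum_(j < r) _.
transitivity (D * S - w * T^-1 * (g2 * D) + w * (z * (1 + u 1%N)) *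
   (g1 * (1 - u 1%N * z)) + w * T^-1 * z ^+ r).
  by rewrite -D0; ring.
(* The two copies of u_1^-r cancel, as do the powers of z; the power of T^-1 - 1 left over is the
   last term of [B]. *)
rewrite e1 e2 /z divfK //; ring.
Qed.

Lemma subr_div_neq0 (T a b : K) : b != 0 -> T * b - a != 0 -> T - a / b != 0.
Proof.
move=> b0; apply: contra_neq => /eqP; rewrite subr_eq0 => /eqP ->.
by rewrite divfK // subrr.
Qed.

Lemma horner_family (a t T : K) r (b : 'I_r -> K) :
  ('X^(r.+1) - a *: 'X^r - t *: \sum_(i < r) b i *: 'X^i).[T] =
  T ^+ r.+1 - a * T ^+ r - t * \sum_(i < r) b i * T ^+ i.
Proof.
rewrite !hornerE horner_sum; congr (_ - _ * _).
by apply: eq_bigr => i _; rewrite !hornerE.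
Qed.

(** Collecting [g] and [g'] in the recurrence gives g' (D - t B) = g (D - (t - 1) B), and the common
    factor [C] drops out. *)
Lemma ratio_recl (D B t C p p' g g' : K) : D != 0 -> C != 0 -> D - t * B != 0 ->
  p * D = C * (D - t * B) -> p' * D = C * (D - (t - 1) * B) ->
  D * (g' - g) = B * (t * g' + (1 - t) * g) -> p != 0 /\ g' * p = g * p'.
Proof.
move=> nD nC nDB ep ep' eg; split.
  by apply: contra_neq (mulf_neq0 nC nDB) => p0; rewrite -ep p0 mul0r.
apply: (mulIf nD); rewrite -!mulrA ep ep' !(mulrCA _ C); congr (_ * _).
apply/eqP; rewrite -subr_eq0; apply/eqP.
transitivity (D * (g' - g) - B * (t * g' + (1 - t) * g)); first by ring.
by rewrite eg subrr.
Qed.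

End FieldIdentities.

(** * The recurrence in n for the generating series *)

Section Recurrence.
Variables (F : fieldType) (r : nat).
Implicit Types X : F.

Definition sc (c : F) : series F r := mpsC _ c%:P.

(** With [X = 1 / (1 - q ^+ m)], these are the denominator and the numerator
    of the generating function [A] of the terms [hterm q a m], [a > 0]. *)
Definition denA X : series F r := 1 - uvar F r 1 * sc (X - 1).
Definition numA X : series F r :=
  denA X * (\sum_(j < r) uvar F r j.+2 * sc (X * (X - 1) ^+ j))
  + uvar F r r.+2 * sc (X * (X - 1) ^+ r).

Lemma uvarE i : uvar F r i = mps_of 'X_(inord i.-1). Proof. exact: mpsXE. Qed.

Lemma geometric_ring (R : comNzRingType) (x : R) n :
  (1 - x) * \sum_(i < n) x ^+ i = 1 - x ^+ n.
Proof. by rewrite -opprB mulNr -subrX1 opprB. Qed.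

(** The entries above r form a geometric progression of ratio u_1 (X - 1). Multiplying by [denA X]
    sums it, up to a remainder containing u_1^M. *)
Lemma denA_trunc X M :
  denA X * mps_of (\sum_(1 <= a < (r + M).+1)
    (X * (X - 1) ^+ a.-1)%:P *: 'X_[emon r a]) =
  numA X - (uvar F r 1 * sc (X - 1)) ^+ M
    * (uvar F r r.+2 * sc (X * (X - 1) ^+ r)).
Proof.
rewrite big_add1 big_mkord rmorph_sum big_split_ord /= mulrDr /numA -addrA.
congr (_ + _).
  congr (_ * _); apply: eq_bigr => i _.
  rewrite /emon ltn_ord mps_ofZ mulrC.
  by rewrite uvarE.
transitivity (denA X * (\sum_(b < M) (uvar F r 1 * sc (X - 1)) ^+ b)
    * (uvar F r r.+2 * sc (X * (X - 1) ^+ r))).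
  rewrite -mulrA big_distrl /=; congr (_ * _); apply: eq_bigr => b _.
  rewrite /emon ltnNge leq_addr /= subSS addKn mpolyXD -mpolyXn.
  rewrite mps_ofZ [mps_of (_ * _)]rmorphM /= [mps_of (_ ^+ _)]rmorphXn /=.
  rewrite !uvarE /= exprMn /sc.
  rewrite !(rmorphM, rmorphXn, exprD) /=; ring.
by rewrite /denA geometric_ring mulrBl mul1r.
Qed.

Lemma hterm_geomB (q : F) a m : q ^+ m != 1 ->
  hterm q a.+1 m = (1 - q ^+ m)^-1 * ((1 - q ^+ m)^-1 - 1) ^+ a.
Proof.
move=> qm1; rewrite hterm_geom; congr (_ * _ ^+ _).
by field; rewrite subr_eq0 eq_sym.
Qed.

Lemma gftrunc_zt_recl (q : F) n N L : (0 < n)%N -> q ^+ n != 1 ->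
  let X := (1 - q ^+ n)^-1 in
  gftrunc r (zt q n.+1) N L.+1 - gftrunc r (zt q n) N L.+1 =
    (\sum_(1 <= a < N.+1) (X * (X - 1) ^+ a.-1)%:P *: 'X_[emon r a])
    * ('X%:MP * gftrunc r (zt q n.+1) N L
       + (1 - 'X)%:MP * gftrunc r (zt q n) N L).
Proof.
move=> n0 qn1 X.
rewrite (@gftrunc_recl r _ _ _
  (fun s => 'X * zt q n.+1 s + (1 - 'X) * zt q n s)
  (fun a => (hterm q a n)%:P)) //; last first.
  by move=> a s a0 sp; apply: zt_recl.
congr (_ * _).
  by apply: eq_big_nat => -[//|a] _; rewrite hterm_geomB.
rewrite !mul_mpolyC /gftrunc !scaler_sumr -big_split /=.
by apply: eq_bigr => s _; rewrite scalerDl !scalerA.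
Qed.

(** Modulo each power of the ideal of the variables, the series may be replaced by truncations,
    which satisfy the recurrence up to the remainder of [denA_trunc]. *)
Lemma gf_zt_recl (q : F) n : (0 < n)%N -> q ^+ n != 1 ->
  let X := (1 - q ^+ n)^-1 in
  denA X * (gf r (zt q n.+1) - gf r (zt q n)) =
    numA X * (mpsC _ 'X * gf r (zt q n.+1) + (1 - mpsC _ 'X) * gf r (zt q n)).
Proof.
move=> n0 qn1 X; apply/eqP; rewrite -subr_eq0; apply/eqP/low_eq0 => d.
set t := mpsC _ 'X; set g1 := gf r _; set g0 := gf r _.
pose N := (r + d)%N.
have low1 L : (d <= L)%N -> low d (g1 - mps_of (gftrunc r (zt q n.+1) N L)).
  by apply: gf_trunc; rewrite addnC.
have low0 L : (d <= L)%N -> low d (g0 - mps_of (gftrunc r (zt q n) N L)).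
  by apply: gf_trunc; rewrite addnC.
have := congr1 (@mps_of _ _) (gftrunc_zt_recl N d n0 qn1); rewrite -/X /=.
rewrite [LHS]rmorphB [RHS]rmorphM [X in _ = _ * X -> _]rmorphD /=.
rewrite !(rmorphM (@mps_of _ _)) /= -!mpsCE -/t rmorphB rmorph1 -/t.
have := denA_trunc X d; rewrite -/N.
(* Both length bounds are needed: [gftrunc_zt_recl] has d + 1 on its left and d on its right. *)
move: (low1 _ (leqnn d)) (low0 _ (leqnn d)).
move: (low1 _ (leqnSn d)) (low0 _ (leqnSn d)).
set p1' := mps_of _; set p0' := mps_of _; set p1 := mps_of _.
set p0 := mps_of _; set A := mps_of _ => l1' l0' l1 l0.
set E := _ ^+ d * _ => eA ep.
have lowE : low d E.
  rewrite /E exprMn -mulrA mulrC; apply: lowM.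
  rewrite uvarE -rmorphXn /= mpolyXn; apply: lowX.
  by rewrite mdegMn mdeg1 mul1n.
have -> : denA X * (g1 - g0) - numA X * (t * g1 + (1 - t) * g0) =
  denA X * ((g1 - p1') - (g0 - p0'))
  - numA X * (t * (g1 - p1) + (1 - t) * (g0 - p0))
  - (t * p1 + (1 - t) * p0) * E.
  have -> : E = numA X - denA X * A by rewrite eA opprB addrC subrK.
  have -> : p1' = p0' + A * (t * p1 + (1 - t) * p0) by rewrite -ep addrC subrK.
  by ring.
apply: lowB; last exact: lowM.
apply: lowB; first by apply: lowM; apply: lowB.
by apply: lowM; apply: lowD; apply: lowM.
Qed.

End Recurrence.

(** * Nonvanishing and factorization in the field of fractions *)

Section Fractions.
Variables (F : fieldType) (r : nat).
Implicit Types (c X : F) (f : series F r).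

Lemma sc_is_zmod_morphism : zmod_morphism (@sc F r).
Proof. by move=> c d; rewrite /sc !rmorphB. Qed.
Lemma sc_is_monoid_morphism : monoid_morphism (@sc F r).
Proof. by split=> [|c d]; rewrite /sc ?rmorph1 ?rmorphM. Qed.
HB.instance Definition _ := GRing.isZmodMorphism.Build F (series F r)
  (@sc F r) sc_is_zmod_morphism.
HB.instance Definition _ := GRing.isMonoidMorphism.Build F (series F r)
  (@sc F r) sc_is_monoid_morphism.

(** The constant coefficient is [c]; this supplies most of the nonvanishing facts needed for
    division. *)
Lemma sc_low_neq0 c f : c != 0 -> low 1 f -> sc r c + f != 0.
Proof.
move=> c0 lf; apply/eqP => /(congr1 (fun g => mpsc g 0%MM)) /=.
rewrite lf ?mdeg0 // eqxx addr0 => /eqP; rewrite polyC_eq0.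
exact/negP.
Qed.

Lemma low_uvar i : low 1 (uvar F r i).
Proof. by rewrite uvarE; apply: lowX; rewrite mdeg1. Qed.

Lemma uvar_neq0 i : uvar F r i != 0.
Proof.
apply/eqP => /(congr1 (fun g => mpsc g U_(inord i.-1)%MM)) /= /eqP.
by rewrite eqxx oner_eq0.
Qed.

Lemma uvar_low_neq0 c i f : c != 0 -> sc r c + f * uvar F r i != 0.
Proof. by move=> c0; apply: sc_low_neq0 => //; apply/lowM/low_uvar. Qed.

Lemma low_numA X : low 1 (numA r X).
Proof.
apply: lowD; last by rewrite mulrC; apply/lowM/low_uvar.
apply: lowM; elim/big_ind: _ => [|f g|j _] //; first exact: lowD.
by rewrite mulrC; apply/lowM/low_uvar.
Qed.

Lemma den_numA_neq0 f X : denA r X - f * numA r X != 0.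
Proof.
rewrite /denA -(rmorph1 (@sc F r)) -addrA; apply: sc_low_neq0.
  exact: oner_neq0.
apply: lowB; last exact/lowM/low_numA.
by apply: lowN; rewrite mulrC; apply/lowM/low_uvar.
Qed.

Lemma denA_neq0 X : denA r X != 0.
Proof. by have := den_numA_neq0 0 X; rewrite mul0r subr0. Qed.

Lemma cstE c : cst r c = (sc r c)%:F. Proof. by []. Qed.

Definition Tq (q : F) n : fracs F r := 1 - cst r q ^+ n.

Lemma TqE q n : Tq q n = (sc r (1 - q ^+ n))%:F.
Proof. by rewrite /Tq cstE !(rmorphB, rmorph1, rmorphXn). Qed.

Lemma TqV q n : q ^+ n != 1 -> (Tq q n)^-1 = (sc r (1 - q ^+ n)^-1)%:F.
Proof.
move=> qn1; apply: mulr1_eq; rewrite TqE -!rmorphM /= divff ?rmorph1 //.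
by rewrite subr_eq0 eq_sym.
Qed.

Lemma PtE (t T : fracs F r) : (Pt t).[T] =
  T ^+ r.+1 - (xs F r 1 + t * xs F r 2) * T ^+ r
  - t * \sum_(i < r) (xs F r (r.+2 - i) - xs F r 1 * xs F r (r.+1 - i)) * T ^+ i.
Proof. exact: horner_family. Qed.

Lemma xsE i :
  xs F r i.+2 = \sum_(i.+2 <= j < r.+2) (-1) ^+ (j - i.+2) * 'C(j - 2, i)%:R
      * ((uvar F r j)%:F - (uvar F r r.+2)%:F / (uvar F r 1)%:F ^+ (r.+2 - j))
    + (uvar F r r.+2)%:F /
      ((uvar F r 1)%:F ^+ (r - i) * (1 + (uvar F r 1)%:F) ^+ i.+1).
Proof. by rewrite /xs !subSS !subn0. Qed.

(** The factor [C] is chosen before t, so the same one serves P^t and P^(t-1). *)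
Lemma Pt_factor (q : F) n : q ^+ n != 1 ->
  exists2 C : fracs F r, C != 0 & forall t,
    let X := (1 - q ^+ n)^-1 in
    (Pt t).[Tq q n] * (denA r X)%:F = C * ((denA r X)%:F - t * (numA r X)%:F).
Proof.
move=> qn1; pose X := (1 - q ^+ n)^-1.
have nz : 1 - q ^+ n != 0 by rewrite subr_eq0 eq_sym.
pose u i : fracs F r := (uvar F r i)%:F.
have u0 : u 1%N != 0 by rewrite tofrac_eq0 uvar_neq0.
have u1 : 1 + u 1%N != 0.
  have := uvar_low_neq0 1 1 (oner_neq0 F); rewrite mul1r rmorph1.
  by rewrite -tofrac_eq0 rmorphD rmorph1.
have T0 : Tq q n != 0.
  rewrite TqE tofrac_eq0; have := sc_low_neq0 nz (f := 0); rewrite addr0.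
  by apply.
(* Written as T + (T - 1) u_1, this has constant term 1 - q^n. *)
have Tu : Tq q n * (1 + u 1%N) - u 1%N != 0.
  have := uvar_low_neq0 1 (sc r (1 - q ^+ n) - 1) nz.
  rewrite -tofrac_eq0 TqE /u.
  by rewrite tofracD tofracM tofracB tofrac1 mulrBl mul1r mulrDr mulr1 addrA.
have Tx : Tq q n - xs F r 1 != 0 by exact: subr_div_neq0.
exists (Tq q n ^+ r * (Tq q n - xs F r 1)).
  by rewrite mulf_neq0 ?expf_neq0.
move=> t; rewrite PtE.
have := @horner_factor _ u (xs F r) t (Tq q n) r (erefl _) xsE u0 u1 T0 Tu; cbv zeta.
have -> : 1 - u 1%N * ((Tq q n)^-1 - 1) = (denA r X)%:F.
  by rewrite TqV // /u !(rmorphB, rmorphM, rmorph1).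
have -> // : (denA r X)%:F *
    (\sum_(j < r) u j.+2 * ((Tq q n)^-1 * ((Tq q n)^-1 - 1) ^+ j))
    + u r.+2 * ((Tq q n)^-1 * ((Tq q n)^-1 - 1) ^+ r) = (numA r X)%:F.
rewrite TqV // /numA [RHS]tofracD [X in _ = X + _]tofracM rmorph_sum /=.
congr (_ * _ + _); last by rewrite tofracM !(rmorphM, rmorphXn, rmorphB, rmorph1).
by apply: eq_bigr => j _; rewrite tofracM !(rmorphM, rmorphXn, rmorphB, rmorph1).
Qed.

End Fractions.

(** * The product formula by induction on n *)

Section Product.
Variables (F : fieldType) (q : F) (r : nat).

Lemma zt1 a k : zt q 1 (a :: k) = 0.
Proof.
rewrite zt_fill big1 // => b _.
rewrite (_ : hsum q 1 _ = 0) ?polyC0 ?mul0r //.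
case: b => b _ /=; elim: k a b => [|c k IH] a [|[] b] /=; rewrite ?big_geq //.
Qed.

Lemma gf_zt1 : gf r (zt q 1) = 1.
Proof.
apply: mpsP => m /=; rewrite big_mkcond (bigD1_seq [::]) ?uniq_words ?mem_words //=.
rewrite big1 => [|[|a s] // _]; last by rewrite zt1 if_same.
by rewrite /smon big_nil addr0 eq_sym.
Qed.

Lemma gf_zt_Pt n : (0 < n)%N -> q ^+ n != 1 ->
  (Pt (tpar F r)).[1 - cst r q ^+ n] != 0 /\
  (gf r (zt q n.+1))%:F * (Pt (tpar F r)).[1 - cst r q ^+ n] =
  (gf r (zt q n))%:F * (Pt (tpar F r - 1)).[1 - cst r q ^+ n].
Proof.
move=> n0 qn1; have [C C0 PtC] := Pt_factor r qn1.
have := gf_zt_recl r n0 qn1; have PtC1 := PtC (tpar F r).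
have PtC2 := PtC (tpar F r - 1); move: PtC1 PtC2; cbv zeta.
set X := (1 - q ^+ n)^-1.
have DB0 : (denA r X)%:F - tpar F r * (numA r X)%:F != 0.
  by rewrite -tofracM -tofracB tofrac_eq0 den_numA_neq0.
have D0 : (denA r X)%:F != 0 by rewrite tofrac_eq0 denA_neq0.
move: D0 DB0; move: (denA r X) (numA r X) => D B D0 DB0 e1 e2.
move=> /(congr1 (@FracField.tofrac _)) e3.
apply: (ratio_recl D0 C0 DB0 e1 e2).
move: e3; rewrite tofracM tofracB => ->.
by rewrite tofracM tofracD !tofracM tofracB tofrac1.
Qed.

End Product.

Theorem theorem1p1 (R : realType) (q : R[i]) (n r : nat)
    (n_gt0 : (0 < n)%N) (r_gt0 : (0 < r)%N)
    (q_neq1 : forall m : nat, (0 < m)%N -> (m < n)%N -> q ^+ m != 1) :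
  (Psi n q r)%:F =
    (\prod_(1 <= j < n) (Pt (tpar _ r - 1)).[1 - cst r q ^+ j])
    / (\prod_(1 <= j < n) (Pt (tpar _ r)).[1 - cst r q ^+ j]).
Proof.
rewrite Psi_gf //; case: n n_gt0 q_neq1 => [//|n] _.
(* The base case has bound 1: no positive index lies below it, so only the empty multi-index
   contributes and both products are empty. *)
elim: n => [|n IH] q1; first by rewrite !big_geq // gf_zt1 tofrac1 divr1.
have [|P0 e] := @gf_zt_Pt _ q r n.+1 isT; first exact: q1.
rewrite big_nat_recr // [in X in _ = _ / X]big_nat_recr //=.
have IH' := IH (fun m m0 mn => q1 m m0 (leqW mn)).
rewrite invfM mulrACA -IH'.
by apply: (mulIf P0); rewrite e -mulrA divfK.
Qed.
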